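(* Let $C$ be a field of characteristic zero, let $S := C[s,t,\frac{1}{3s^2-1}]/(s^3-s-t^2)$, and let $\partial : S \to S$ be the unique derivation extending the derivation $\frac{d}{dt}$ on $C[t]$ (so $\partial|_C=0$, $\partial(t)=1$ and $\partial(s)=\frac{2t}{3s^2-1}$). Let $M$ be the $S$-module generated by two elements $f_1, f_2$ subject to the relations $t f_1 - s f_2 = 0$ and $(s^2-1) f_1 - t f_2 = 0$. Then for every $b \in S$, $$\partial_M(f_1) := b f_1 + \frac{3s^2+1}{3s^2-1} f_2 \quad\text{and}\quad \partial_M(f_2) := s f_1 + b f_2$$ defines a derivation $\partial_M$ on $M$. Furthermore, every derivation on $M$ can be written in this form, i.e. for every derivation $\partial_M$ on $M$ there is some $b \in S$ such that $\partial_M(f_1)$ and $\partial_M(f_2)$ are given by the formulas above.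
   Context: The ring $S$ is the localisation of $C[s,t]/(s^3-s-t^2)$ obtained by inverting $3s^2-1$; it is \'etale over $C[t]$, so the derivation $\frac{d}{dt}$ on $C[t]$ extends uniquely to $S$. A derivation on the $S$-module $M$ (with respect to $\partial$) is an additive map $\partial_M : M \to M$ such that $\partial_M(rm) = \partial(r) m + r\,\partial_M(m)$ for all $r \in S$, $m \in M$. That the given values on $f_1,f_2$ ''define a derivation on $M$'' means that there is a (necessarily unique) derivation $\partial_M$ on $M$ taking these values on the generators $f_1,f_2$. *)

(* Defs.v *)
From HB Require Import structures.
From mathcomp Require Import all_boot all_order all_algebra.
From mathcomp Require Import generic_quotient ring_quotient boolp.
From mathcomp.multinomials Require Import mpoly.
From mathcomp Require Import ring.

Set Implicit Arguments.
Unset Strict Implicit.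
Unset Printing Implicit Defensive.

Import GRing.Theory.
Local Open Scope ring_scope.
Local Open Scope quotient_scope.

Definition derivation (R : pzRingType) (d : R -> R) : Prop :=
  (forall x y, d (x + y) = d x + d y) /\
  (forall x y, d (x * y) = d x * y + x * d y).

Definition mod_derivation (R : pzRingType) (d : R -> R) (M : lmodType R)
    (dM : M -> M) : Prop :=
  (forall x y, dM (x + y) = dM x + dM y) /\
  (forall r x, dM (r *: x) = d r *: x + r *: dM x).

Section DerivationTheory.
Variables (R : pzRingType) (d : R -> R) (dP : derivation d).

Lemma derivationD x y : d (x + y) = d x + d y. Proof. exact: dP.1. Qed.
Lemma derivationM x y : d (x * y) = d x * y + x * d y.
Proof. exact: dP.2. Qed.
Lemma derivation0 : d 0 = 0.
Proof. by apply: (addrI (d 0)); rewrite -derivationD !addr0. Qed.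
Lemma derivation1 : d 1 = 0.
Proof.
apply: (addrI (d 1)); rewrite addr0.
by have := derivationM 1 1; rewrite !mulr1 mul1r => <-.
Qed.
Lemma derivationN x : d (- x) = - d x.
Proof.
by apply: (addrI (d x)); rewrite -derivationD !subrr derivation0.
Qed.
Lemma derivation_nat n : d n%:R = 0.
Proof.
elim: n => [|n IH]; first exact: derivation0.
by rewrite -addn1 natrD derivationD IH derivation1 addr0.
Qed.
End DerivationTheory.

Section CurveRing.
Variable C : fieldType.

(* The variables 0, 1, 2 of {mpoly C[3]} stand for s, t and 1/(3s^2-1): the
   localisation A[1/f] is taken as A[u]/(u f - 1). *)
Definition varS : {mpoly C[3]} := 'X_(0 : 'I_3).
Definition varT : {mpoly C[3]} := 'X_(1 : 'I_3).
Definition varU : {mpoly C[3]} := 'X_(2 : 'I_3).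

Definition curve_rel : {mpoly C[3]} := varS ^+ 3 - varS - varT ^+ 2.
Definition inv_rel : {mpoly C[3]} := varU * (3 * varS ^+ 2 - 1) - 1.

Definition curve_ideal (p : {mpoly C[3]}) : bool :=
  `[< exists a b, p = a * curve_rel + b * inv_rel >].

Lemma curve_ideal_closed : idealr_closed curve_ideal.
Proof.
split.
- by apply/asboolP; exists 0, 0; rewrite !mul0r addr0.
- apply/asboolP => -[a [b e]].
  pose v (i : 'I_3) : C := if i == 2 :> 'I_3 then -1 else 0.
  have := congr1 (meval v) e.
  rewrite /curve_rel /inv_rel /varS /varT /varU.
  rewrite !(mevalD, mevalN, mevalM, meval1, mevalXU, rmorphXn) /v /=.
  rewrite ?mevalXU /=.
  move=> h; have : (1 : C) = 0 by rewrite h; ring.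
  by move/eqP; rewrite oner_eq0.
- move=> c p q /asboolP[a [b ->]] /asboolP[a' [b' ->]].
  by apply/asboolP; exists (c * a + a'), (c * b + b'); ring.
Qed.

HB.instance Definition _ :=
  isIdealr.Build {mpoly C[3]} curve_ideal curve_ideal_closed.

Definition ringS : Type := {ideal_quot (Idealr.clone _ curve_ideal _)}.
HB.instance Definition _ := GRing.ComNzRing.on ringS.

Definition projS (p : {mpoly C[3]}) : ringS := \pi p.

Lemma projS_is_zmod : zmod_morphism projS.
Proof. exact: raddfB. Qed.
Lemma projS_is_monoid : monoid_morphism projS.
Proof. by split; [exact: rmorph1 | exact: rmorphM]. Qed.
HB.instance Definition _ :=
  GRing.isZmodMorphism.Build {mpoly C[3]} ringS projS projS_is_zmod.
HB.instance Definition _ :=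
  GRing.isMonoidMorphism.Build {mpoly C[3]} ringS projS projS_is_monoid.

Lemma projS_eq0 p : projS p = 0 <->
  exists a b, p = a * curve_rel + b * inv_rel.
Proof.
rewrite -(rmorph0 projS); split.
- by move/eqP; rewrite -Quotient.idealrBE subr0 => /asboolP.
- move=> e; apply/eqP; rewrite -Quotient.idealrBE subr0; exact/asboolP.
Qed.

Lemma projS_surj (x : ringS) : exists p, projS p = x.
Proof. by exists (repr x); rewrite /projS reprK. Qed.

Definition unitS (x : ringS) : bool := `[< exists y, y * x = 1 >].

Definition invS (x : ringS) : ringS :=
  match pselect (exists y, y * x = 1) with
  | left h => sval (cid h)
  | right _ => x
  end.

Lemma mulVS : {in unitS, left_inverse 1 invS *%R}.
Proof.
move=> x /asboolP ux; rewrite /invS; case: pselect => // h; exact: svalP (cid h).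
Qed.

Lemma unitSPl (x y : ringS) : y * x = 1 -> unitS x.
Proof. by move=> e; apply/asboolP; exists y. Qed.

Lemma invS_out : {in [predC unitS], invS =1 id}.
Proof.
move=> x ux; rewrite /invS; case: pselect => // h.
by case/negP: ux; exact: asboolT h.
Qed.

HB.instance Definition _ :=
  GRing.ComNzRing_hasMulInverse.Build ringS mulVS unitSPl invS_out.

Definition s : ringS := projS varS.
Definition t : ringS := projS varT.

(* The structure map C[t] -> S. *)
Definition polyS (p : {poly C}) : ringS :=
  (map_poly (projS \o @mpolyC 3 C) p).[t].

Lemma curve_eq : s ^+ 3 - s = t ^+ 2.
Proof.
apply/eqP; rewrite -subr_eq0; apply/eqP.
rewrite /s /t -!rmorphXn -!rmorphB; apply/projS_eq0.
by exists 1, 0; rewrite mul1r mul0r addr0.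
Qed.

Lemma projS_inv : projS varU * (3 * s ^+ 2 - 1) = 1.
Proof.
apply/eqP; rewrite -subr_eq0; apply/eqP.
have -> : projS varU * (3 * s ^+ 2 - 1) - 1 = projS inv_rel.
  by rewrite /inv_rel !(rmorphB, rmorphM, rmorphXn, rmorph1, rmorph_nat).
by apply/projS_eq0; exists 0, 1; rewrite mul1r mul0r add0r.
Qed.

Lemma unit_3s2B1 : 3 * s ^+ 2 - 1 \is a GRing.unit.
Proof. exact: unitSPl projS_inv. Qed.


Definition extends_ddt (d : ringS -> ringS) : Prop :=
  forall p, d (polyS p) = polyS p^`().

Lemma polySX : polyS 'X = t.
Proof. by rewrite /polyS map_polyX hornerX. Qed.

Lemma polySC c : polyS c%:P = projS c%:MP.
Proof. by rewrite /polyS map_polyC hornerC. Qed.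

Lemma polyS_is_zmod : zmod_morphism polyS.
Proof. by move=> p q; rewrite /polyS rmorphB hornerD hornerN. Qed.
Lemma polyS_is_monoid : monoid_morphism polyS.
Proof.
by split=> [|p q]; rewrite /polyS ?rmorph1 ?hornerC // rmorphM hornerM.
Qed.
HB.instance Definition _ :=
  GRing.isZmodMorphism.Build {poly C} ringS polyS polyS_is_zmod.
HB.instance Definition _ :=
  GRing.isMonoidMorphism.Build {poly C} ringS polyS polyS_is_monoid.

Lemma derivation_ddt_s d : derivation d -> extends_ddt d ->
  d s = 2 * t / (3 * s ^+ 2 - 1).
Proof.
move=> dP dt; apply: (mulIr unit_3s2B1); rewrite divrK ?unit_3s2B1 //.
have dT : d t = 1 by rewrite -polySX dt derivX rmorph1.
have := congr1 d curve_eq; rewrite !exprS expr0 !mulr1.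
rewrite !(derivationD dP, derivationM dP, derivationN dP) dT => e.
transitivity (d s * (s * s) + s * (d s * s + s * d s) - d s); first ring.
by rewrite e; ring.
Qed.

Lemma derivation_ddt_unique d d' : derivation d -> derivation d' ->
  extends_ddt d -> extends_ddt d' -> d = d'.
Proof.
move=> dP dP' dt dt'; apply/funext => x; have [p <-] := projS_surj x.
have eC c : d (projS c%:MP) = d' (projS c%:MP) by rewrite -polySC dt dt'.
have es : d s = d' s by rewrite !derivation_ddt_s.
have et : d t = d' t by rewrite -polySX dt dt'.
have eu : d (projS varU) = d' (projS varU).
  have ud f : derivation f -> f (projS varU) =
      - projS varU * projS varU * (3 * (f s * s + s * f s)).
    move=> fP; apply: (mulIr unit_3s2B1).
    have := congr1 f projS_inv; rewrite (derivation1 fP) (derivationM fP) => e.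
    have -> : f (projS varU) * (3 * s ^+ 2 - 1) =
       - projS varU * f (3 * s ^+ 2 - 1) by rewrite mulNr; apply/eqP; rewrite -addr_eq0 e.
    have -> : f (3 * s ^+ 2 - 1) = 3 * (f s * s + s * f s).
      rewrite (derivationD fP) (derivationN fP) (derivation1 fP) oppr0 addr0.
      by rewrite (derivationM fP) (derivation_nat fP) mul0r add0r expr2 (derivationM fP).
    set w := 3 * (f s * s + s * f s).
    transitivity (- projS varU * w * (projS varU * (3 * s ^+ 2 - 1))).
      by rewrite projS_inv mulr1.
    by ring.
  by rewrite (ud d dP) (ud d' dP') es.
have eX (i : 'I_3) : d (projS 'X_i) = d' (projS 'X_i).
  by case: i => -[|[|[|//]]] h; [rewrite (_ : Ordinal h = 0)|
    rewrite (_ : Ordinal h = 1)|rewrite (_ : Ordinal h = 2)] => //; apply/val_inj.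
elim/mpolyind: p => [|c m p _ _ IH].
  by rewrite rmorph0 (derivation0 dP) (derivation0 dP').
rewrite rmorphD (derivationD dP) (derivationD dP') IH; congr (_ + _).
rewrite -mul_mpolyC rmorphM (derivationM dP) (derivationM dP') eC.
suff -> : d (projS 'X_[m]) = d' (projS 'X_[m]) by [].
rewrite mpolyXE_id; elim/big_rec: _ => [|i q _ IHq].
  by rewrite rmorph1 (derivation1 dP) (derivation1 dP').
rewrite rmorphM (derivationM dP) (derivationM dP') IHq.
suff -> : d (projS ('X_i ^+ m i)) = d' (projS ('X_i ^+ m i)) by [].
elim: (m i) => [|k IHk].
  by rewrite rmorph1 (derivation1 dP) (derivation1 dP').
by rewrite exprS rmorphM (derivationM dP) (derivationM dP') IHk eX.
Qed.

Lemma derivation_ddt_ex : exists d, derivation d /\ extends_ddt d.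
Proof.
pose D (p : {mpoly C[3]}) := 2 * varT * varU * p^`M(0 : 'I_3) + p^`M(1 : 'I_3)
  - 12 * varS * varT * varU ^+ 3 * p^`M(2 : 'I_3).
have DD p q : D (p + q) = D p + D q by rewrite /D !mderivD; ring.
have DN p : D (- p) = - D p by rewrite /D !mderivN; ring.
have DM p q : D (p * q) = D p * q + p * D q by rewrite /D !mderivM; ring.
have DP : derivation D by split.
have DC c : D c%:MP = 0 by rewrite /D !mderivC; ring.
have dX i j : ('X_i : {mpoly C[3]})^`M(j) = (i == j)%:R.
  rewrite mderivX mnm1E; case: eqP => [->|_]; last by rewrite scale0r.
  rewrite scale1r (_ : (_ - _)%MM = 0%MM) ?mpolyX0 //.
  by apply/mnmP => k; rewrite mnmBE mnm0E subnn.
have DX : D varS = 2 * varT * varU by rewrite /D /varS !dX /= -/varS; ring.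
have DY : D varT = 1 by rewrite /D {2 3 5}/varT !dX /=; ring.
have DU : D varU = - (12 * varS * varT * varU ^+ 3).
  by rewrite /D {2 3 5}/varU !dX /=; ring.
have D1 : D 1 = 0 := derivation1 DP.
have Dr1 : D curve_rel = 2 * varT * inv_rel.
  rewrite /curve_rel /inv_rel !exprS expr0 !mulr1 !(DD, DN, DM) DX DY; ring.
have Dr2 : D inv_rel = - (12 * varS * varT * varU ^+ 2) * inv_rel.
  rewrite /inv_rel !exprS expr0 !mulr1 !(DD, DN, DM) DX DU D1.
  by ring.
have DI p q : projS p = projS q -> projS (D p) = projS (D q).
  move=> e; apply/eqP; rewrite -subr_eq0 -rmorphB -DN -DD; apply/eqP.
  have /projS_eq0[a [b ->]] : projS (p - q) = 0 by rewrite rmorphB /= e subrr.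
  apply/projS_eq0; exists (D a), (a * (2 * varT) + D b - b * (12 * varS * varT * varU ^+ 2)).
  by rewrite DD !DM Dr1 Dr2; ring.
pose d (x : ringS) : ringS := projS (D (repr x)).
have dE p : d (projS p) = projS (D p) by apply: DI; rewrite /projS reprK.
have dP : derivation d.
  split=> x y; have [p <-] := projS_surj x; have [q <-] := projS_surj y.
    by rewrite -rmorphD !dE DD rmorphD.
  by rewrite -rmorphM !dE DM rmorphD !rmorphM.
exists d; split=> // p; elim/poly_ind: p => [|p c IH].
  by rewrite rmorph0 (derivation0 dP) deriv0 rmorph0.
rewrite derivMXaddC !rmorphD !rmorphM /= polySX polySC.
rewrite (derivationD dP) (derivationM dP) IH !dE DY DC rmorph1 rmorph0.
by ring.
Qed.

(* (a, b) is the element a e_1 + b e_2 of the free module S^2 *)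
Definition free2 := (ringS^o * ringS^o)%type.

Definition rel1 : free2 := (t, - s).
Definition rel2 : free2 := (s ^+ 2 - 1, - t).

Definition relM (x : free2) : bool :=
  `[< exists a b : ringS, x = a *: rel1 + b *: rel2 >].

Lemma relM_closed : submod_closed relM.
Proof.
split; first by apply/asboolP; exists 0, 0; rewrite !scale0r addr0.
move=> c x y /asboolP[a [b ->]] /asboolP[a' [b' ->]].
apply/asboolP; exists (c * a + a'), (c * b + b').
by rewrite scalerDr !scalerA !scalerDl addrACA.
Qed.

HB.instance Definition _ :=
  GRing.isSubmodClosed.Build ringS free2 relM relM_closed.

Definition modM : Type := @Quotient.quot free2 (GRing.ZmodClosed.clone _ relM _).
HB.instance Definition _ := GRing.Zmodule.on modM.

Definition projM (x : free2) : modM := \pi x.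

Lemma projM_is_zmod : zmod_morphism projM.
Proof. exact: raddfB. Qed.
HB.instance Definition _ :=
  GRing.isZmodMorphism.Build free2 modM projM projM_is_zmod.

Lemma projM_surj (x : modM) : exists v, projM v = x.
Proof. by exists (repr x); rewrite /projM reprK. Qed.

Lemma projM_eq (x y : free2) : projM x = projM y <-> relM (x - y).
Proof.
split=> [/eqP|h]; first by rewrite -Quotient.idealrBE.
by apply/eqP; rewrite -Quotient.idealrBE.
Qed.

Definition scaleM (a : ringS) (x : modM) : modM := projM (a *: repr x).

Lemma scaleM_proj a v : scaleM a (projM v) = projM (a *: v).
Proof.
apply/projM_eq; rewrite -scalerBr; apply: rpredZ.
by apply/projM_eq; rewrite /projM reprK.
Qed.

Lemma scaleMA a b x : scaleM a (scaleM b x) = scaleM (a * b) x.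
Proof. by have [v <-] := projM_surj x; rewrite !scaleM_proj scalerA. Qed.

Lemma scaleM1 : left_id 1 scaleM.
Proof. by move=> x; have [v <-] := projM_surj x; rewrite scaleM_proj scale1r. Qed.

Lemma scaleMDr : right_distributive scaleM +%R.
Proof.
move=> a x y; have [v <-] := projM_surj x; have [w <-] := projM_surj y.
by rewrite -raddfD !scaleM_proj -raddfD scalerDr.
Qed.

Lemma scaleMDl x : {morph scaleM^~ x : a b / a + b}.
Proof.
move=> a b; have [v <-] := projM_surj x.
by rewrite !scaleM_proj -raddfD scalerDl.
Qed.

HB.instance Definition _ := GRing.Zmodule_isLmodule.Build ringS modM
  scaleMA scaleM1 scaleMDr scaleMDl.

Lemma projM_is_scalable : scalable projM.
Proof. by move=> a v; rewrite -scaleM_proj. Qed.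
HB.instance Definition _ :=
  GRing.isScalable.Build ringS free2 modM *:%R projM projM_is_scalable.

Definition f1 : modM := projM ((1, 0) : free2).
Definition f2 : modM := projM ((0, 1) : free2).

Lemma projME (a b : ringS) : projM (a, b) = a *: f1 + b *: f2.
Proof.
rewrite -!linearZ -raddfD; congr projM.
by apply/pair_equal_spec; rewrite /= !scaler0 add0r addr0 /GRing.scale /= !mulr1.
Qed.

Lemma modM_gen (x : modM) : exists a b : ringS, x = a *: f1 + b *: f2.
Proof. by have [[a b] <-] := projM_surj x; exists a, b; rewrite projME. Qed.

Lemma modM_eq0 (a b : ringS) : a *: f1 + b *: f2 = 0 <->
  exists c e, a = c * t + e * (s ^+ 2 - 1) /\ b = - (c * s) - e * t.
Proof.
have E c e : c *: rel1 + e *: rel2 =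
    (c * t + e * (s ^+ 2 - 1), - (c * s) - e * t) :> free2.
  by apply/pair_equal_spec; split=> //=; rewrite -!mulrN.
rewrite -projME -(raddf0 projM); split.
  by move/projM_eq; rewrite subr0 => /asboolP[c [e]]; rewrite E => -[-> ->]; exists c, e.
move=> [c [e [-> ->]]]; apply/projM_eq; rewrite subr0; apply/asboolP.
by exists c, e; rewrite E.
Qed.

End CurveRing.

Arguments s {C}.
Arguments t {C}.
Arguments f1 {C}.
Arguments f2 {C}.

(* Main.v *)
From HB Require Import structures.
Require Import Defs.
From mathcomp Require Import all_boot all_order all_algebra.
From mathcomp Require Import boolp ring.
From mathcomp.multinomials Require Import mpoly.

(** The map [x f1 + y f2 |-> s x + t y] identifies [M] with the ideal [(s, t)]
    of [S]. Injectivity only needs that [s] is a nonzerodivisor of [S], since [s]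
    and [s^2 - 1] are comaximal and [t (s, t) = s (t, s^2 - 1)]. Both the
    well-definedness of the derivation and the fact that two derivations of [M]
    differ by multiplication with an element of [S] (an endomorphism of the
    invertible ideal [(s, t)]) then become identities in [S]. *)

Set Implicit Arguments.
Unset Strict Implicit.
Unset Printing Implicit Defensive.

Import GRing.Theory.
Local Open Scope ring_scope.

(** * Setting one variable of a polynomial ring to zero *)

Section Substitution0.
Variables (n : nat) (R : comNzRingType) (i : 'I_n).

Definition mpoly_subst0 (p : {mpoly R[n]}) : {mpoly R[n]} :=
  mmap (@mpolyC n R) (fun j => if j == i then 0 else 'X_j) p.

Lemma mpoly_subst0_is_zmod : zmod_morphism mpoly_subst0.
Proof. exact: mmapB. Qed.
Lemma mpoly_subst0_is_monoid : monoid_morphism mpoly_subst0.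
Proof. by split; [exact: rmorph1 | exact: rmorphM]. Qed.
HB.instance Definition _ := GRing.isZmodMorphism.Build _ _ mpoly_subst0
  mpoly_subst0_is_zmod.
HB.instance Definition _ := GRing.isMonoidMorphism.Build _ _ mpoly_subst0
  mpoly_subst0_is_monoid.

Lemma mpoly_subst0X j : mpoly_subst0 'X_j = if j == i then 0 else 'X_j.
Proof. by rewrite /mpoly_subst0 mmapX mmap1U. Qed.

(** Substitution and identity are ring maps that agree modulo ['X_i] on constants and variables,
    hence everywhere. This gives division by ['X_i] with a remainder free of ['X_i]. *)
Lemma mpoly_subst0_mod (p : {mpoly R[n]}) :
  exists q, p = mpoly_subst0 p + 'X_i * q.
Proof.
elim/mpolyind: p => [|c m p _ _ [q ep]].
  by exists 0; rewrite rmorph0 mulr0 addr0.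
suff [q' em]: exists q', 'X_[m] = mpoly_subst0 'X_[m] + 'X_i * q'.
  exists (c *: q' + q); rewrite rmorphD /= {1}ep {1}em -!mul_mpolyC rmorphM /=.
  rewrite /mpoly_subst0 mmapC -/(mpoly_subst0 _) -/(mpoly_subst0 _); ring.
rewrite mpolyXE_id; elim/big_rec: _ => [|j r _ [q' er]].
  by exists 0; rewrite rmorph1 mulr0 addr0.
have [q2 ej]: exists q2, 'X_j ^+ m j = mpoly_subst0 ('X_j ^+ m j) + 'X_i * q2.
  elim: (m j) => [|k [q2 ek]]; first by exists 0; rewrite rmorph1 mulr0 addr0.
  rewrite exprS rmorphM /= mpoly_subst0X; case: eqP => [->|_].
    by exists ('X_i ^+ k); rewrite mul0r add0r.
  by exists ('X_j * q2); rewrite {1}ek; ring.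
exists (mpoly_subst0 ('X_j ^+ m j) * q' + q2 * r).
transitivity ((mpoly_subst0 ('X_j ^+ m j) + 'X_i * q2) * r).
  by rewrite -ej.
by rewrite rmorphM /= mulrDl {1}er; ring.
Qed.

End Substitution0.

(** * Derivations on a module with two generators *)

Section TwoGenerators.
Variables (R : pzRingType) (M : lmodType R) (u v : M).
Implicit Types (a b : R) (d : R -> R) (D : M -> M).

Lemma comb2_eq a b a' b' :
  a = a' -> b = b' -> a *: u + b *: v = a' *: u + b' *: v.
Proof. by move=> -> ->. Qed.

Lemma comb2D a b a' b' :
  (a *: u + b *: v) + (a' *: u + b' *: v) = (a + a') *: u + (b + b') *: v.
Proof. by rewrite addrACA !scalerDl. Qed.

Lemma comb2_eq0 a b a' b' : a *: u + b *: v = a' *: u + b' *: v ->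
  (a - a') *: u + (b - b') *: v = 0.
Proof.
by move=> e; rewrite !scalerBl addrACA -opprD e subrr.
Qed.

Lemma comb2Dl b r w w' :
  w = w' + r *: u -> w' = 0 *: u + b *: v -> w = r *: u + b *: v.
Proof. by move=> -> ->; rewrite scale0r add0r addrC. Qed.

Lemma comb2Dr a r w w' :
  w = w' + r *: v -> w' = a *: u + 0 *: v -> w = a *: u + r *: v.
Proof. by move=> -> ->; rewrite scale0r addr0. Qed.

Lemma comb2Z r a b : r *: (a *: u + b *: v) = (r * a) *: u + (r * b) *: v.
Proof. by rewrite scalerDr !scalerA. Qed.

Lemma comb2Z_eq r r' a b a' b' w w' :
  w = a *: u + b *: v -> w' = a' *: u + b' *: v -> r *: w = r' *: w' ->
  (r * a) *: u + (r * b) *: v = (r' * a') *: u + (r' * b') *: v.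
Proof. by move=> -> ->; rewrite !comb2Z. Qed.

Lemma comb2_10 : 1 *: u + 0 *: v = u.
Proof. by rewrite scale1r scale0r addr0. Qed.

Lemma comb2_01 : 0 *: u + 1 *: v = v.
Proof. by rewrite scale1r scale0r add0r. Qed.

Lemma mod_derivation_comb2 d D a b : mod_derivation d D ->
  D (a *: u + b *: v) = (d a *: u + a *: D u) + (d b *: v + b *: D v).
Proof. by move=> [DD DZ]; rewrite DD !DZ. Qed.

(** The terms [d r *: w] cancel, so the difference of two derivations is linear. *)
Lemma mod_derivation_subZ d D D' r w :
  mod_derivation d D -> mod_derivation d D' ->
  D (r *: w) - D' (r *: w) = r *: (D w - D' w).
Proof.
by move=> [_ DZ] [_ DZ']; rewrite DZ DZ' scalerBr opprD addrACA subrr add0r.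
Qed.

Lemma eq_addZ_comb2 w w' a b r : w - w' = a *: u + b *: v ->
  (a - r) *: u + b *: v = 0 -> w = w' + r *: u.
Proof.
move=> e h; rewrite addrC; apply/eqP; rewrite -subr_eq e -subr_eq0.
by rewrite addrAC -scalerBl h.
Qed.

(** Descent from the free module of coordinate pairs: two pairs for one element differ by a
    relation, on which the additive [D] vanishes, so any choice of coordinates gives the same
    value. *)
Lemma mod_derivation_lift d (D : R -> R -> M) :
  (forall w, exists a b, w = a *: u + b *: v) ->
  (forall a b a' b', D (a + a') (b + b') = D a b + D a' b') ->
  (forall r a b, D (r * a) (r * b) = d r *: (a *: u + b *: v) + r *: D a b) ->
  (forall a b, a *: u + b *: v = 0 -> D a b = 0) ->
  exists dM : M -> M,
    mod_derivation d dM /\ forall a b, dM (a *: u + b *: v) = D a b.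
Proof.
move=> gen DD DZ D0.
have gen2 w : exists c : R * R, w = c.1 *: u + c.2 *: v.
  by have [a [b ->]] := gen w; exists (a, b).
have [co coP] := choice gen2; pose dM w := D (co w).1 (co w).2.
have dME a b : dM (a *: u + b *: v) = D a b.
  rewrite /dM; have := coP (a *: u + b *: v).
  case: (co _) => a' b' /= /esym/comb2_eq0 /D0 e.
  transitivity (D (a' - a + a) (b' - b + b)); first by rewrite !subrK.
  by rewrite DD e add0r.
exists dM; split=> //; split=> [w w'|r w]; have [a [b ->]] := gen w.
  by have [a' [b' ->]] := gen w'; rewrite comb2D !dME DD.
by rewrite comb2Z !dME DZ.
Qed.

End TwoGenerators.

(** * The module as the ideal [(s, t)], and its derivations *)

Section CurveModule.
Variable C : fieldType.
Implicit Types x y : ringS C.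

(* Modulo [s] the two relations become [- t^2] and [- (u + 1)], which form a
   regular sequence in [C[t, u]]; cancelling [t] twice gives the Koszul syzygy. *)
Lemma mul_s_eq0 x : s * x = 0 -> x = 0.
Proof.
have [p <-] := projS_surj x; rewrite /s -rmorphM.
move/projS_eq0 => [a [b e]]; apply/projS_eq0.
pose E0 := @mpoly_subst0 3 C 0; pose E1 := @mpoly_subst0 3 C 1.
have [a' ea] := mpoly_subst0_mod 0 a; have [b' eb] := mpoly_subst0_mod 0 b.
rewrite -/(varS C) -/E0 in ea eb.
have E0S : E0 (varS C) = 0 by rewrite /E0 mpoly_subst0X.
have E0T : E0 (varT C) = varT C by rewrite /E0 mpoly_subst0X.
have E0U : E0 (varU C) = varU C by rewrite /E0 mpoly_subst0X.
have E1T : E1 (varT C) = 0 by rewrite /E1 mpoly_subst0X.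
have E1U : E1 (varU C) = varU C by rewrite /E1 mpoly_subst0X.
have X0 i : ('X_i : {mpoly C[3]}) != 0.
  by rewrite -msupp_eq0 msuppX.
have T0 : varT C != 0 := X0 1.
have S0 : varS C != 0 := X0 0.
have U0 : varU C + 1 != 0.
  apply/eqP => /(congr1 (meval (fun=> 0))).
  rewrite mevalD meval1 mevalXU meval0 add0r => /eqP; by rewrite oner_eq0.
have e0 : E0 a * varT C ^+ 2 + E0 b * (varU C + 1) = 0.
  move: (congr1 E0 e); rewrite /E0 /curve_rel /inv_rel.
  rewrite !(rmorphM, rmorphD, rmorphN, rmorphXn, rmorph1, rmorph_nat) /=.
  rewrite -/E0 E0S E0T E0U => e0; apply: oppr_inj; rewrite oppr0.
  by transitivity (0 * E0 p); [rewrite e0|]; ring.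
have divT q q' : q' * varT C + q * (varU C + 1) = 0 ->
    exists k, q = varT C * k /\ q' + k * (varU C + 1) = 0.
  move=> eq; have [k ek] := mpoly_subst0_mod 1 q.
  have : E1 q * (varU C + 1) = 0.
    move: (congr1 E1 eq); rewrite /E1.
    rewrite !(rmorphM, rmorphD, rmorph1, rmorph0) /= -/E1 E1T E1U.
    by rewrite mulr0 add0r.
  move/eqP; rewrite mulf_eq0 (negPf U0) orbF => /eqP eq0.
  rewrite -/(varT C) -/E1 eq0 add0r in ek; exists k; split=> //.
  by apply: (mulfI T0); rewrite mulr0 -eq ek; ring.
have [k [ek e1]] : exists k, E0 b = varT C * k /\
    E0 a * varT C + k * (varU C + 1) = 0.
  by apply: divT; rewrite -e0; ring.
have [k' [ek' e2]] := divT _ _ e1.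
(* The part of the right-hand side without [a'] and [b'] is [k' * (t^2 * inv_rel - (u + 1) *
   curve_rel)]. Inserting [t^2 = s (s^2 - 1) - curve_rel] and [u + 1 = 3 u s^2 - inv_rel] cancels
   the products of the two relators and leaves a multiple of [s]. *)
exists (a' - k' * (varU C * 3 * varS C)), (b' + k' * (varS C ^+ 2 - 1)).
apply: (mulfI S0); rewrite e ea eb ek ek'.
have -> : E0 a = - (k' * (varU C + 1)) by apply/eqP; rewrite -addr_eq0 e2.
rewrite /curve_rel /inv_rel; ring.
Qed.

(** By the curve equation, [s] times the conclusion is [t] times the hypothesis; then cancel [s]. *)
Lemma ideal_syzygy x y : s * x + t * y = 0 -> t * x + (s ^+ 2 - 1) * y = 0.
Proof.
move=> e; apply: mul_s_eq0.
transitivity (t * (s * x + t * y)); last by rewrite e mulr0.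
transitivity (s * t * x + (s ^+ 3 - s) * y); first by ring.
by rewrite curve_eq; ring.
Qed.

Lemma modM_eq0_ideal x y : x *: f1 + y *: f2 = 0 <-> s * x + t * y = 0.
Proof.
split=> [/modM_eq0[c [e [-> ->]]]|e].
  by transitivity (e * (s ^+ 3 - s - t ^+ 2)); [ring | rewrite curve_eq; ring].
have e' := ideal_syzygy e.
(* Both witnesses come from [1 = s^2 - (s^2 - 1)]: multiply it by [x] and use [s x = - t y], or by
   [y] and use [(s^2 - 1) y = - t x]. *)
apply/modM_eq0; exists (- (s * y)), (- x); split; apply/eqP; rewrite -subr_eq0.
- by apply/eqP; transitivity (s * (s * x + t * y)); [ring | rewrite e mulr0].
- apply/eqP; transitivity (- (t * x + (s ^+ 2 - 1) * y)); first by ring.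
  by rewrite e' oppr0.
Qed.

Lemma modM_rel1 : t *: f1 = s *: f2 :> modM C.
Proof.
apply/eqP; rewrite -subr_eq0 -scaleNr; apply/eqP/modM_eq0_ideal; ring.
Qed.

Lemma modM_rel2 : (s ^+ 2 - 1) *: f1 = t *: f2 :> modM C.
Proof.
apply/eqP; rewrite -subr_eq0 -scaleNr; apply/eqP/modM_eq0_ideal.
by transitivity (s ^+ 3 - s - t ^+ 2 : ringS C); [ring | rewrite curve_eq subrr].
Qed.

Lemma mod_derivation_eq (d : ringS C -> ringS C) (D D' : modM C -> modM C) :
  mod_derivation d D -> mod_derivation d D' ->
  D f1 = D' f1 -> D f2 = D' f2 -> D = D'.
Proof.
move=> DP DP' e1 e2; apply/funext => m; have [x [y ->]] := modM_gen m.
by rewrite (mod_derivation_comb2 _ _ _ _ DP) (mod_derivation_comb2 _ _ _ _ DP') e1 e2.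
Qed.

Lemma modM_inj a b a' b' :
  a *: f1 + b *: f2 = a' *: f1 + b' *: f2 :> modM C ->
  s * a + t * b = s * a' + t * b'.
Proof.
move=> /comb2_eq0/modM_eq0_ideal h.
by apply/eqP; rewrite -subr_eq0 -h; apply/eqP; ring.
Qed.

Lemma mod_derivation_diff (d : ringS C -> ringS C) (D D' : modM C -> modM C) :
  mod_derivation d D -> mod_derivation d D' ->
  exists b : ringS C, D f1 = D' f1 + b *: f1 /\ D f2 = D' f2 + b *: f2.
Proof.
move=> DP DP'; have phiZ r w := mod_derivation_subZ r w DP DP'.
have [a [c e1]] := modM_gen (D f1 - D' f1).
have [e [g e2]] := modM_gen (D f2 - D' f2).
(* Let [A = s a + t c] and [B = s e + t g] be the images of [(D - D') f1] and [(D - D') f2] in the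
   ideal. By linearity the two relations of the module become [t A = s B] and
   [(s^2 - 1) A = t B]. *)
have r1 : t * (s * a + t * c) = s * (s * e + t * g).
  have /modM_inj h : (t * a) *: f1 + (t * c) *: f2
      = (s * e) *: f1 + (s * g) *: f2 :> modM C.
    apply: (comb2Z_eq e1 e2); rewrite -[LHS]phiZ -[RHS]phiZ.
    by rewrite modM_rel1.
  by transitivity (s * (t * a) + t * (t * c)); [|rewrite h]; ring.
have r2 : (s ^+ 2 - 1) * (s * a + t * c) = t * (s * e + t * g).
  have /modM_inj h : ((s ^+ 2 - 1) * a) *: f1 + ((s ^+ 2 - 1) * c) *: f2
      = (t * e) *: f1 + (t * g) *: f2 :> modM C.
    apply: (comb2Z_eq e1 e2); rewrite -[LHS]phiZ -[RHS]phiZ.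
    by rewrite modM_rel2.
  by transitivity (s * ((s ^+ 2 - 1) * a) + t * ((s ^+ 2 - 1) * c));
    [|rewrite h]; ring.
(* [D - D'], viewed as an endomorphism [phi] of the ideal [(s, t)], is
   multiplication by [b = phi s / s]. *)
pose b := s * (s * a + t * c) - t * e - (s ^+ 2 - 1) * g.
(* Here [A = s^2 A - (s^2 - 1) A = s^2 A - t B], and [t^2 = s^3 - s] makes [t B] divisible by [s];
   the quotient is [b]. *)
have hA : s * a + t * c = s * b.
  transitivity (s ^+ 2 * (s * a + t * c) - (s ^+ 2 - 1) * (s * a + t * c)).
    by ring.
  rewrite r2; transitivity (s * b + (s ^+ 3 - s - t ^+ 2) * g).
    by rewrite /b; ring.
  by rewrite curve_eq subrr mul0r addr0.
have hB : s * e + t * g = t * b.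
  apply/eqP; rewrite -subr_eq0; apply/eqP/mul_s_eq0.
  by rewrite mulrBr -r1 hA; ring.
exists b; split.
- apply: eq_addZ_comb2 e1 _; apply/modM_eq0_ideal.
  by rewrite mulrBr addrAC hA subrr.
- rewrite [RHS]addrC in e2; apply: eq_addZ_comb2 e2 _.
  rewrite addrC; apply/modM_eq0_ideal.
  by rewrite mulrBr addrA hB subrr.
Qed.

Lemma mod_derivation_ex (d : ringS C -> ringS C) (b : ringS C) :
  derivation d -> extends_ddt d -> exists dM : modM C -> modM C,
    [/\ mod_derivation d dM,
        dM f1 = b *: f1 + ((3 * s ^+ 2 + 1) / (3 * s ^+ 2 - 1)) *: f2 &
        dM f2 = s *: f1 + b *: f2].
Proof.
move=> dP dt; set c := _ / _.
have ds := derivation_ddt_s dP dt.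
have dT : d t = 1 by rewrite -polySX dt derivX rmorph1.
(* This identity dictates the coefficient [c]: after clearing the denominator it reads
   [(3 s^2 + 1) - 2 = 3 s^2 - 1], times [t]. *)
have tc : t * c - d s = t.
  apply: (mulIr (unit_3s2B1 C)); rewrite ds mulrBl mulrA !divrK ?unit_3s2B1 //.
  by ring.
pose D x y := (d x + b * x + s * y) *: f1 + (d y + c * x + b * y) *: f2 : modM C.
have DD x y x' y' : D (x + x') (y + y') = D x y + D x' y'.
  rewrite /D comb2D !(derivationD dP).
  by apply: comb2_eq; ring.
have DZ r x y : D (r * x) (r * y) = d r *: (x *: f1 + y *: f2) + r *: D x y.
  rewrite /D !comb2Z comb2D !(derivationM dP).
  by apply: comb2_eq; ring.
have D0 x y : x *: f1 + y *: f2 = 0 :> modM C -> D x y = 0.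
  move/modM_eq0_ideal => e; apply/modM_eq0_ideal.
  have e' := ideal_syzygy e.
  have := congr1 d e.
  rewrite (derivation0 dP) (derivationD dP) !(derivationM dP) dT => de.
  (* The image of [D x y] in the ideal is [d (s x + t y) + b (s x + t y)] plus a remainder, which by
     [tc] is the expression killed by [ideal_syzygy]. *)
  transitivity ((d s * x + s * d x + (1 * y + t * d y)) + b * (s * x + t * y)
    + ((t * c - d s) * x + (s ^+ 2 - 1) * y)); first by ring.
  by rewrite tc de e e'; ring.
have [dM [dMP dME]] := mod_derivation_lift (@modM_gen C) DD DZ D0.
exists dM; split=> //.
- rewrite -[f1 in LHS](comb2_10 f1 f2) dME.
  rewrite /D (derivation0 dP) (derivation1 dP).
  by apply: comb2_eq; ring.
- rewrite -[f2 in LHS](comb2_01 f1 f2) dME.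
  rewrite /D (derivation0 dP) (derivation1 dP).
  by apply: comb2_eq; ring.
Qed.

End CurveModule.

(** * Existence, uniqueness and classification *)

Theorem theorem5p2 (C : fieldType) (charC0 : [pchar C] =i pred0)
    (d : ringS C -> ringS C) (d_derivation : derivation d)
    (d_ddt : extends_ddt d) :
  (forall b : ringS C, exists! dM : modM C -> modM C,
     [/\ mod_derivation d dM,
         dM f1 = b *: f1 + ((3 * s ^+ 2 + 1) / (3 * s ^+ 2 - 1)) *: f2 &
         dM f2 = s *: f1 + b *: f2]) /\
  (forall dM : modM C -> modM C, mod_derivation d dM ->
     exists b : ringS C,
       dM f1 = b *: f1 + ((3 * s ^+ 2 + 1) / (3 * s ^+ 2 - 1)) *: f2 /\
       dM f2 = s *: f1 + b *: f2).
Proof.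
split=> [b|dM dMP].
  have [dM [dMP e1 e2]] := mod_derivation_ex b d_derivation d_ddt.
  exists dM; split=> // dM' [dMP' e1' e2'].
  by apply: mod_derivation_eq dMP dMP' _ _; rewrite ?e1 ?e2.
(* The derivation with parameter [0] is the base point; the factor by which [dM] differs from it is
   the required [b]. *)
have [dM0 [dMP0 e1 e2]] := mod_derivation_ex 0 d_derivation d_ddt.
have [b [h1 h2]] := mod_derivation_diff dMP dMP0.
exists b; split; [exact: comb2Dl h1 e1 | exact: comb2Dr h2 e2].
Qed.
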